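(* Let $k \geq 2$ be an integer, let $\ell := \lfloor \log_2 k \rfloor$, and let $p_1 < \cdots < p_\ell$ be $\ell$ pairwise distinct prime numbers. Then there exists a partition of $\mathbb{N}$ into $k$ sets $A_1, \ldots, A_k$ such that, for each $i = 1, \ldots, \ell$, none of $R(A_1), \ldots, R(A_k)$ is dense in $\mathbb{Q}_{p_i}$.
   Context: $\mathbb{N}$ denotes the set of positive integers. For $A \subseteq \mathbb{N}$, $R(A) := \{a/b : a, b \in A\}$, viewed as a subset of $\mathbb{Q}_p$ with the $p$-adic topology. $\lfloor x \rfloor$ is the greatest integer not exceeding $x$ and $\log_2$ is the base-$2$ logarithm. *)

(* Defs.v *)
From HB Require Import structures.
From mathcomp Require Import all_boot all_order all_algebra.
From mathcomp Require Import all_classical all_reals all_analysis.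
From mathcomp Require Import ring.

Set Implicit Arguments.
Unset Strict Implicit.
Unset Printing Implicit Defensive.

Import Order.TTheory GRing.Theory Num.Theory.
Import numFieldNormedType.Exports.

Local Open Scope classical_set_scope.
Local Open Scope quotient_scope.
Local Open Scope ring_scope.

(* The field of p-adic numbers is not in the libraries: it is built here as the
   completion of rat for the p-adic absolute value, i.e. as the ring of p-adic
   Cauchy sequences of rationals modulo the null sequences.  The construction
   goes through for every p : nat, but it only means Q_p when p is prime (for
   the other p, logn p = 0 and padic_abs p is the trivial absolute value). *)

Definition padic_val (p : nat) (x : rat) : int :=
  (logn p `|numq x|)%:Z - (logn p `|denq x|)%:Z.

Definition padic_abs (p : nat) (x : rat) : rat :=
  if x == 0 then 0 else p%:R ^ (- padic_val p x).

Arguments padic_val p%_N x%_R.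
Arguments padic_abs p%_N x%_R.

Section PadicAbs.
Variable p : nat.
Implicit Types (x y z : rat).
Local Notation abs := (padic_abs p).

Lemma padic_abs0 : abs 0 = 0.
Proof. by rewrite /padic_abs eqxx. Qed.

Lemma padic_abs1 : abs 1 = 1.
Proof.
by rewrite /padic_abs oner_eq0 /padic_val (numq_int 1) (denq_int 1) /= logn1 subrr oppr0 expr0z.
Qed.

Lemma padic_absN x : abs (- x) = abs x.
Proof. by rewrite /padic_abs oppr_eq0 /padic_val numqN denqN abszN. Qed.

Lemma padic_val_frac (a b : int) : a != 0 -> b != 0 ->
  padic_val p (a%:~R / b%:~R) = (logn p `|a|)%:Z - (logn p `|b|)%:Z.
Proof.
move=> a0 b0; set x := _ / _.
have x0 : x != 0 by rewrite mulf_neq0 ?invr_eq0 ?intr_eq0.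
have /eqP : (numq x)%:~R * b%:~R = a%:~R * (denq x)%:~R :> rat.
  rewrite numqE -/x mulrAC /x divfK ?intr_eq0//.
rewrite -!intrM eqr_int => /eqP /(congr1 (fun z : int => logn p `|z|%N)).
rewrite !abszM !lognM ?absz_gt0 ?numq_eq0 ?denq_neq0//.
move=> /(congr1 Posz); rewrite !PoszD => e.
by apply/eqP; rewrite /padic_val subr_eq addrAC eq_sym subr_eq e.
Qed.

Lemma padic_abs_nprime x : ~~ prime p -> x != 0 -> abs x = 1.
Proof.
move=> pp x0; have logp0 n : logn p n = 0%N by rewrite lognE (negPf pp).
by rewrite /padic_abs (negPf x0) /padic_val !logp0 subrr oppr0 expr0z.
Qed.

Lemma padic_abs_neq0 x : x != 0 -> abs x != 0.
Proof.
move=> x0; have [pp|pp] := boolP (prime p); last first.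
  by rewrite padic_abs_nprime ?oner_neq0.
by rewrite /padic_abs (negPf x0) expfz_neq0// pnatr_eq0 -lt0n prime_gt0.
Qed.

Lemma padic_abs_ge0 x : 0 <= abs x.
Proof. by rewrite /padic_abs; case: ifP => // _; rewrite exprz_ge0. Qed.

Lemma padic_abs_eq0 x : (abs x == 0) = (x == 0).
Proof.
have [->|x0] := eqVneq x 0; first by rewrite padic_abs0 eqxx.
by rewrite (negPf (padic_abs_neq0 x0)).
Qed.

Lemma padic_absM x y : abs (x * y) = abs x * abs y.
Proof.
have [->|x0] := eqVneq x 0; first by rewrite mul0r padic_abs0 mul0r.
have [->|y0] := eqVneq y 0; first by rewrite mulr0 padic_abs0 mulr0.
have [pp|pp] := boolP (prime p); last first.
  by rewrite !padic_abs_nprime ?mulf_neq0// mulr1.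
rewrite /padic_abs mulf_eq0 (negPf x0) (negPf y0) /=.
rewrite -expfzDr ?pnatr_eq0 -?lt0n ?prime_gt0//; congr (_ ^ _).
rewrite -opprD; congr (- _).
rewrite -[in LHS](divq_num_den x) -[in LHS](divq_num_den y) mulf_div -!intrM.
rewrite padic_val_frac ?mulf_neq0 ?numq_eq0 ?denq_neq0//.
rewrite !abszM !lognM ?absz_gt0 ?numq_eq0 ?denq_neq0//.
by rewrite !PoszD opprD addrACA.
Qed.

Lemma padic_abs_frac (a b : int) : a != 0 -> b != 0 -> abs (a%:~R / b%:~R) =
  p%:R ^ ((logn p `|b|)%:Z - (logn p `|a|)%:Z).
Proof.
move=> a0 b0; rewrite /padic_abs mulf_eq0 invr_eq0 !intr_eq0 (negPf a0) (negPf b0).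
by rewrite /= padic_val_frac// opprB.
Qed.

Lemma padic_absD x y : abs (x + y) <= Num.max (abs x) (abs y).
Proof.
have [->|x0] := eqVneq x 0; first by rewrite add0r le_max lexx orbT.
have [->|y0] := eqVneq y 0; first by rewrite addr0 le_max lexx.
have [->|s0] := eqVneq (x + y) 0; first by rewrite padic_abs0 le_max padic_abs_ge0.
have [pp|pp] := boolP (prime p); last by rewrite !padic_abs_nprime// le_max lexx.
pose a := numq x * denq y; pose b := numq y * denq x; pose d := denq x * denq y.
have d0 : d != 0 by rewrite mulf_neq0 ?denq_neq0.
have a0 : a != 0 by rewrite mulf_neq0 ?numq_eq0 ?denq_neq0.
have b0 : b != 0 by rewrite mulf_neq0 ?numq_eq0 ?denq_neq0.
have xE : x = a%:~R / d%:~R.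
  by rewrite /a /d !intrM -mulf_div divq_num_den divff ?mulr1// intr_eq0 denq_neq0.
have yE : y = b%:~R / d%:~R.
  rewrite /b /d [denq x * _]mulrC !intrM -mulf_div divq_num_den divff ?mulr1//.
  by rewrite intr_eq0 denq_neq0.
have sE : x + y = (a + b)%:~R / d%:~R by rewrite xE yE -mulrDl -intrD.
have ab0 : a + b != 0.
  by apply: contra_neq s0 => ab0; rewrite sE ab0 mul0r.
rewrite sE [X in abs X <= _]lock xE yE -lock !padic_abs_frac// le_max.
have p1 : 1 < p%:R :> rat by rewrite ltr1n prime_gt1.
rewrite !ler_eXz2l// !lerD2l !lerN2 !lez_nat.
have g0 (z : int) : z != 0 -> (0 < `|z|)%N by rewrite absz_gt0.
have [le|/ltnW le] := leqP (logn p `|a|) (logn p `|b|); apply/orP; [left|right].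
- rewrite -pfactor_dvdn ?g0//.
  suff : (Posz (p ^ logn p `|a|) %| a + b)%Z by rewrite dvdzE.
  apply: rpredD; rewrite dvdzE /=; first exact: pfactor_dvdnn.
  by rewrite pfactor_dvdn ?g0.
- rewrite -pfactor_dvdn ?g0//.
  suff : (Posz (p ^ logn p `|b|) %| a + b)%Z by rewrite dvdzE.
  apply: rpredD; rewrite dvdzE /=; last exact: pfactor_dvdnn.
  by rewrite pfactor_dvdn ?g0.
Qed.

Lemma padic_absB x y : abs (x - y) <= Num.max (abs x) (abs y).
Proof. by rewrite -(padic_absN y) padic_absD. Qed.

Lemma padic_abs_isosceles x y : abs (x - y) < abs y -> abs x = abs y.
Proof.
move=> xy; apply/eqP; rewrite eq_le; apply/andP; split.
  by rewrite -[x](subrK y) (le_trans (padic_absD _ _))// ge_max lexx (ltW xy).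
rewrite leNgt; apply/negP => xy'.
have := padic_absB x (x - y); rewrite opprB addrC subrK.
by rewrite leNgt gt_max xy xy'.
Qed.

Lemma padic_absV x : abs x^-1 = (abs x)^-1.
Proof.
have [->|x0] := eqVneq x 0; first by rewrite invr0 padic_abs0 ?invr0.
have a0 := padic_abs_neq0 x0.
by apply: (mulfI a0); rewrite -padic_absM !divff// padic_abs1.
Qed.

End PadicAbs.

Section CauchySequences.
Variable p : nat.
Local Notation abs := (padic_abs p).

Definition padic_cauchy : {pred nat -> rat} := fun u =>
  `[< forall e : rat, 0 < e -> exists N : nat, forall m n : nat,
      (N <= m)%N -> (N <= n)%N -> abs (u m - u n) < e >].

Definition padic_null : {pred nat -> rat} := fun u =>
  `[< forall e : rat, 0 < e -> exists N : nat, forall n : nat,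
      (N <= n)%N -> abs (u n) < e >].

Lemma padic_cauchyP u : reflect (forall e : rat, 0 < e -> exists N : nat,
   forall m n : nat, (N <= m)%N -> (N <= n)%N -> abs (u m - u n) < e)
  (u \in padic_cauchy).
Proof. exact: asboolP. Qed.

Lemma padic_nullP u : reflect (forall e : rat, 0 < e -> exists N : nat,
   forall n : nat, (N <= n)%N -> abs (u n) < e) (u \in padic_null).
Proof. exact: asboolP. Qed.

Lemma padic_cauchy_bounded u : u \in padic_cauchy ->
  exists N M, 0 < M /\ forall n, (N <= n)%N -> abs (u n) < M.
Proof.
move=> /padic_cauchyP/(_ 1 ltr01)[N HN].
exists N, (abs (u N) + 1); split; first by rewrite ltr_wpDl ?padic_abs_ge0.
move=> n Nn; rewrite -[u n](subrK (u N)) (le_lt_trans (padic_absD _ _ _))//.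
rewrite gt_max ltrDl ltr01 andbT (lt_le_trans (HN _ _ Nn (leqnn _)))//.
by rewrite lerDr padic_abs_ge0.
Qed.

Lemma padic_nullM u v : u \in padic_cauchy -> v \in padic_null ->
  u * v \in padic_null.
Proof.
move=> /padic_cauchy_bounded[N1 [M [M0 HM]]] /padic_nullP nv.
apply/padic_nullP => e e0.
have [N2 H2] := nv _ (divr_gt0 e0 M0); exists (maxn N1 N2) => n.
rewrite geq_max => /andP[n1 n2].
rewrite [(u * v) n]/(u n * v n) padic_absM.
have := H2 _ n2; rewrite ltr_pdivlMr// mulrC; apply: le_lt_trans.
by rewrite ler_wpM2r ?padic_abs_ge0// ltW// HM.
Qed.

Lemma padic_nullB u v : u \in padic_null -> v \in padic_null ->
  u - v \in padic_null.
Proof.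
move=> /padic_nullP nu /padic_nullP nv; apply/padic_nullP => e e0.
have [N1 H1] := nu _ e0; have [N2 H2] := nv _ e0.
exists (maxn N1 N2) => n; rewrite geq_max => /andP[n1 n2].
rewrite [(u - v) n]/(u n - v n) (le_lt_trans (padic_absB _ _ _))//.
by rewrite gt_max H1// H2.
Qed.

Lemma padic_cauchy_cst (c : rat) : (fun=> c) \in padic_cauchy.
Proof. by apply/padic_cauchyP => e e0; exists 0%N => *; rewrite subrr padic_abs0. Qed.

Lemma padic_cauchy_subring : subring_closed padic_cauchy.
Proof.
split=> [|u v|u v].
- exact: padic_cauchy_cst.
- move=> /padic_cauchyP cu /padic_cauchyP cv; apply/padic_cauchyP => e e0.
  have [N1 H1] := cu _ e0; have [N2 H2] := cv _ e0.
  exists (maxn N1 N2) => m n; rewrite !geq_max => /andP[m1 m2] /andP[n1 n2].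
  have E : (u m - v m) - (u n - v n) = (u m - u n) - (v m - v n) by ring.
  rewrite [_ - _](_ : _ = (u m - u n) - (v m - v n)); last exact: E.
  by rewrite (le_lt_trans (padic_absB _ _ _))// gt_max H1// H2.
- move=> cu cv.
  have [N1 [M1 [M10 HM1]]] := padic_cauchy_bounded cu.
  have [N2 [M2 [M20 HM2]]] := padic_cauchy_bounded cv.
  move: cu cv => /padic_cauchyP cu /padic_cauchyP cv; apply/padic_cauchyP => e e0.
  have [N3 H3] := cu _ (divr_gt0 e0 M20); have [N4 H4] := cv _ (divr_gt0 e0 M10).
  exists (maxn (maxn N1 N2) (maxn N3 N4)) => m n; rewrite !geq_max.
  move=> /andP[/andP[m1 m2] /andP[m3 m4]] /andP[/andP[n1 n2] /andP[n3 n4]].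
  rewrite [_ - _](_ : _ = u m * (v m - v n) + (u m - u n) * v n); last first.
    by rewrite [LHS]/(u m * v m - u n * v n) mulrBr mulrBl addrA subrK.
  rewrite (le_lt_trans (padic_absD _ _ _))// gt_max !padic_absM; apply/andP; split.
    have := H4 _ _ m4 n4; rewrite ltr_pdivlMr// mulrC; apply: le_lt_trans.
    by rewrite ler_wpM2r ?padic_abs_ge0// ltW// HM1.
  have := H3 _ _ m3 n3; rewrite ltr_pdivlMr//; apply: le_lt_trans.
  by rewrite ler_wpM2l ?padic_abs_ge0// ltW// HM2.
Qed.

HB.instance Definition _ :=
  GRing.isSubringClosed.Build (nat -> rat) padic_cauchy padic_cauchy_subring.

Record cauchy_seq := CauchySeq {
  cauchy_val :> nat -> rat; cauchy_valP : cauchy_val \in padic_cauchy }.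

HB.instance Definition _ := [isSub for cauchy_val].
HB.instance Definition _ := [Choice of cauchy_seq by <:].
HB.instance Definition _ := [SubChoice_isSubComNzRing of cauchy_seq by <:].

Definition null_ideal : {pred cauchy_seq} :=
  fun u => (u : nat -> rat) \in padic_null.

Lemma null_ideal_closed : idealr_closed null_ideal.
Proof.
split=> [||a u v].
- by apply/padic_nullP => e e0; exists 0%N => n _; rewrite padic_abs0.
- apply/negP => /padic_nullP/(_ 1 ltr01)[N /(_ N (leqnn N))].
  by rewrite [(_ : cauchy_seq) N]/(1 : rat) padic_abs1 ltxx.
- move=> nu nv; rewrite -[v]opprK.
  have nv' : (- v) \in null_ideal.
    move/padic_nullP : nv => nv; apply/padic_nullP => e /nv[N HN]; exists N => n /HN.
    by rewrite [(- v) n]/(- v n) padic_absN.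
  by apply: padic_nullB; first exact: padic_nullM (cauchy_valP a) nu.
Qed.

HB.instance Definition _ :=
  isIdealr.Build cauchy_seq null_ideal null_ideal_closed.

Lemma cauchy_abs_stable (u : cauchy_seq) : u \notin null_ideal ->
  exists c N, 0 < c /\ forall n, (N <= n)%N -> abs (u n) = c.
Proof.
move=> /negP nu; have [N1 [e0 [e0_gt0 [Ne Nn]]]] : exists N e, 0 < e /\
    e <= abs (u N) /\ (forall n, (N <= n)%N -> abs (u n - u N) < e).
  apply: contrapT => H; apply: nu; apply/padic_nullP => e e0.
  have /padic_cauchyP/(_ e e0)[N HN] := cauchy_valP u.
  exists N => n Nn; rewrite ltNge; apply/negP => en; apply: H.
  exists n, e; split=> //; split=> // m nm; apply: HN => //.
  exact: leq_trans nm.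
exists (abs (u N1)), N1; split; first exact: lt_le_trans Ne.
by move=> n /Nn H; apply: padic_abs_isosceles; apply: lt_le_trans Ne.
Qed.

End CauchySequences.

Arguments null_ideal : clear implicits.

Definition padic (p : nat) : Type := {ideal_quot (null_ideal p)}.

HB.instance Definition _ (p : nat) := GRing.ComNzRing.on (padic p).

Section PadicField.
Variable p : nat.
Local Notation abs := (padic_abs p).
Implicit Types (u v : cauchy_seq p) (x y z : padic p).

Definition padic_of_cauchy u : padic p := \pi_({ideal_quot (null_ideal p)}) u.
Definition cauchy_repr x : cauchy_seq p := repr (x : {ideal_quot (null_ideal p)}).

Lemma cauchy_reprK x : padic_of_cauchy (cauchy_repr x) = x.
Proof. exact: reprK. Qed.

Lemma padic_of_cauchyB u v :
  padic_of_cauchy (u - v) = padic_of_cauchy u - padic_of_cauchy v.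
Proof. exact: (rmorphB (\pi_({ideal_quot (null_ideal p)}))). Qed.

Lemma padic_of_cauchyM u v :
  padic_of_cauchy (u * v) = padic_of_cauchy u * padic_of_cauchy v.
Proof. exact: (rmorphM (\pi_({ideal_quot (null_ideal p)}))). Qed.

Lemma padic_of_cauchy_eq0 u : (padic_of_cauchy u == 0) = (u \in null_ideal p).
Proof.
have -> : 0 = padic_of_cauchy 0 by apply/esym/(rmorph0 (\pi_({ideal_quot (null_ideal p)}))).
by rewrite -[in RHS](subr0 u) Quotient.idealrBE.
Qed.

Lemma cauchy_inv_subproof u : u \notin null_ideal p ->
  (fun n => (u n)^-1) \in padic_cauchy p.
Proof.
move=> /cauchy_abs_stable[c [N [c0 HN]]]; apply/padic_cauchyP => e e0.
have /padic_cauchyP/(_ (e * (c * c)))[|M HM] := cauchy_valP u.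
  by rewrite !mulr_gt0.
have u0 n : (N <= n)%N -> u n != 0.
  by move=> /HN un; rewrite -(padic_abs_eq0 p) un gt_eqF.
exists (maxn N M) => m n; rewrite !geq_max => /andP[Nm Mm] /andP[Nn Mn].
have -> : (u m)^-1 - (u n)^-1 = (u n - u m) / (u m * u n).
  rewrite invfM mulrA mulrBl mulrBl; congr (_ - _); last by rewrite divff ?u0// mul1r.
  by rewrite mulrAC divff ?u0// mul1r.
rewrite padic_absM padic_absV padic_absM !HN// ltr_pdivrMr ?mulr_gt0//.
exact: HM.
Qed.

Definition padic_inv x : padic p :=
  if x == 0 then 0
  else padic_of_cauchy (insubd (0 : cauchy_seq p) (fun n => (cauchy_repr x n)^-1)).

Lemma padic_mulVf x : x != 0 -> padic_inv x * x = 1.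
Proof.
move=> x0; rewrite /padic_inv (negPf x0) -[in X in _ * X](cauchy_reprK x).
set u := cauchy_repr x.
have nu : u \notin null_ideal p by rewrite -padic_of_cauchy_eq0 cauchy_reprK.
rewrite -padic_of_cauchyM.
have -> : 1 = padic_of_cauchy 1 by apply/esym/(rmorph1 (\pi_({ideal_quot (null_ideal p)}))).
apply/eqP; rewrite -subr_eq0 -padic_of_cauchyB padic_of_cauchy_eq0.
have [c [N [c0 HN]]] := cauchy_abs_stable nu.
apply/padic_nullP => e e0; exists N => n Nn.
set v := insubd _ _; have vE : v n = (u n)^-1.
  by rewrite /v /insubd insubT ?cauchy_inv_subproof.
rewrite [(_ : cauchy_seq p) n]/(v n * u n - 1) vE mulVf ?subrr ?padic_abs0//.
by rewrite -(padic_abs_eq0 p) HN// gt_eqF.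
Qed.

Lemma padic_inv0 : padic_inv 0 = 0. Proof. by rewrite /padic_inv eqxx. Qed.

HB.instance Definition _ :=
  GRing.ComNzRing_isField.Build (padic p) padic_mulVf padic_inv0.

(* The extension of the absolute value to Q_p; the limit exists already in rat,
   since the sequence of absolute values tends to 0 or is eventually constant. *)
Definition padic_norm x : rat :=
  lim ((abs (cauchy_repr x n) : rat^o) @[n --> \oo]).

Lemma null_abs_cvg u : u \in null_ideal p ->
  (abs (u n) : rat^o) @[n --> \oo] --> (0 : rat^o).
Proof.
move=> /padic_nullP nu; apply/cvgrPdist_lt => e /nu[N HN]; exists N => // n /= Nn.
by rewrite sub0r normrN ger0_norm ?padic_abs_ge0// HN.
Qed.

Lemma padic_norm_cvg u :
  (abs (u n) : rat^o) @[n --> \oo] --> (padic_norm (padic_of_cauchy u) : rat^o).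
Proof.
rewrite /padic_norm; set v := cauchy_repr _.
have vu : v - u \in null_ideal p.
  by rewrite -padic_of_cauchy_eq0 padic_of_cauchyB cauchy_reprK subrr.
have [nu|nu] := boolP (u \in null_ideal p).
  have nv : v \in null_ideal p by rewrite -padic_of_cauchy_eq0 cauchy_reprK padic_of_cauchy_eq0.
  have := null_abs_cvg nv; move/cvg_lim => -> //; exact: null_abs_cvg.
have [c [N [c0 HN]]] := cauchy_abs_stable nu.
have [M HM] : exists M, forall n, (M <= n)%N -> abs (v n - u n) < c.
  by move/padic_nullP: vu => /(_ c c0).
have cst (w : cauchy_seq p) K : (forall n, (K <= n)%N -> abs (w n) = c) ->
    (abs (w n) : rat^o) @[n --> \oo] --> (c : rat^o).
  by move=> HK; apply: cvg_near_cst; exists K => // n /= /HK.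
have -> : lim ((abs (v n) : rat^o) @[n --> \oo]) = c; last exact: cst HN.
apply: cvg_lim => //; apply: (@cst v (maxn N M)) => n.
rewrite geq_max => /andP[/HN un /HM vn]; rewrite -un.
by apply: padic_abs_isosceles; rewrite un.
Qed.

Lemma padic_norm_eq0 x : (padic_norm x == 0) = (x == 0).
Proof.
rewrite -(cauchy_reprK x) padic_of_cauchy_eq0; set u := cauchy_repr x.
have cu := @padic_norm_cvg u.
have [nu|nu] := boolP (u \in null_ideal p).
  by apply/eqP; exact: (cvg_unique (@norm_hausdorff _ rat^o) cu (null_abs_cvg nu)).
have [c [N [c0 HN]]] := cauchy_abs_stable nu.
have uc : (abs (u n) : rat^o) @[n --> \oo] --> (c : rat^o).
  by apply: cvg_near_cst; exists N => // n /= /HN.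
by rewrite (cvg_unique (@norm_hausdorff _ rat^o) cu uc) gt_eqF.
Qed.

Lemma padic_normN x : padic_norm (- x) = padic_norm x.
Proof.
have c1 := @padic_norm_cvg (cauchy_repr x).
have c2 := @padic_norm_cvg (- cauchy_repr x).
have e : (fun n => abs ((- cauchy_repr x) n) : rat^o) =
    (fun n => abs (cauchy_repr x n) : rat^o).
  by apply/funext => n; rewrite [X in abs X]/(- cauchy_repr x n) padic_absN.
move: c2; rewrite e -[- cauchy_repr x]sub0r padic_of_cauchyB cauchy_reprK.
have -> : padic_of_cauchy 0 = 0 by apply/eqP; rewrite padic_of_cauchy_eq0 rpred0.
rewrite sub0r => c2; rewrite cauchy_reprK in c1.
exact: (cvg_unique (@norm_hausdorff _ rat^o) c2 c1).
Qed.

Lemma padic_normM x y : padic_norm (x * y) = padic_norm x * padic_norm y.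
Proof.
rewrite -[in LHS](cauchy_reprK x) -[in LHS](cauchy_reprK y) -padic_of_cauchyM.
have cx := @padic_norm_cvg (cauchy_repr x); rewrite cauchy_reprK in cx.
have cy := @padic_norm_cvg (cauchy_repr y); rewrite cauchy_reprK in cy.
have cxy := @padic_norm_cvg (cauchy_repr x * cauchy_repr y).
apply: (cvg_unique (@norm_hausdorff _ rat^o) cxy).
have -> : (fun n => abs ((cauchy_repr x * cauchy_repr y) n) : rat^o) =
    (fun n => abs (cauchy_repr x n) : rat^o) \* (fun n => abs (cauchy_repr y n) : rat^o).
  by apply/funext => n; exact: (padic_absM p (cauchy_repr x n) (cauchy_repr y n)).
exact: cvgM.
Qed.

Lemma padic_normD x y :
  padic_norm (x + y) <= Num.max (padic_norm x) (padic_norm y).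
Proof.
rewrite -[X in padic_norm (X + _)](cauchy_reprK x).
rewrite -[X in padic_norm (_ + X)](cauchy_reprK y).
have -> : padic_of_cauchy (cauchy_repr x) + padic_of_cauchy (cauchy_repr y) =
    padic_of_cauchy (cauchy_repr x + cauchy_repr y).
  exact/esym/(rmorphD (\pi_({ideal_quot (null_ideal p)}))).
have cx := @padic_norm_cvg (cauchy_repr x); rewrite cauchy_reprK in cx.
have cy := @padic_norm_cvg (cauchy_repr y); rewrite cauchy_reprK in cy.
have cxy := @padic_norm_cvg (cauchy_repr x + cauchy_repr y).
rewrite leNgt; apply/negP => lt_xy; have [lt1 lt2] := midf_lt lt_xy.
set c := (_ / _) in lt1 lt2; move: lt1; rewrite gt_max => /andP[ltx lty].
have /filter_ex[n /=] : \forall n \near \oo, False; last by [].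
near=> n.
have H1 : abs (cauchy_repr x n) < c by near: n; exact: (cvgr_lt _ cx).
have H2 : abs (cauchy_repr y n) < c by near: n; exact: (cvgr_lt _ cy).
have H3 : c < abs (cauchy_repr x n + cauchy_repr y n).
  by near: n; exact: (cvgr_gt _ cxy).
have := padic_absD p (cauchy_repr x n) (cauchy_repr y n).
by rewrite leNgt (lt_trans _ H3)// gt_max H1.
Unshelve. all: by end_near. Qed.

Lemma padic_norm_ge0 x : 0 <= padic_norm x.
Proof.
have := padic_normD x (- x); rewrite padic_normN subrr maxxx.
by have /eqP -> : padic_norm 0 == 0 by rewrite padic_norm_eq0.
Qed.

Definition padic_dist x y : rat := padic_norm (x - y).

Lemma padic_distxx x : padic_dist x x = 0.
Proof. by apply/eqP; rewrite /padic_dist subrr padic_norm_eq0. Qed.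

Lemma padic_dist_positivity x y : padic_dist x y = 0 -> x = y.
Proof. by move/eqP; rewrite padic_norm_eq0 subr_eq0 => /eqP. Qed.

Lemma padic_dist_sym x y : padic_dist x y = padic_dist y x.
Proof. by rewrite /padic_dist -padic_normN opprB. Qed.

Lemma padic_dist_triangle y x z :
  padic_dist x z <= padic_dist x y + padic_dist y z.
Proof.
rewrite /padic_dist -[x in X in X <= _](subrK y) -addrA.
rewrite (le_trans (padic_normD _ _))// ge_max lerDl lerDr.
by rewrite !padic_norm_ge0.
Qed.

HB.instance Definition _ := @isMetric.Build rat (padic p) padic_dist
  padic_distxx padic_dist_positivity padic_dist_sym padic_dist_triangle.

End PadicField.

Section RationalPoints.
Variable p : nat.
Local Notation abs := (padic_abs p).

Definition padic_of_rat (q : rat) : padic p :=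
  padic_of_cauchy (CauchySeq (padic_cauchy_cst p q)).

Lemma padic_of_ratM q r :
  padic_of_rat (q * r) = padic_of_rat q * padic_of_rat r.
Proof.
rewrite /padic_of_rat -padic_of_cauchyM; congr padic_of_cauchy.
exact/val_inj.
Qed.

Lemma padic_of_ratB q r :
  padic_of_rat (q - r) = padic_of_rat q - padic_of_rat r.
Proof.
rewrite /padic_of_rat -padic_of_cauchyB; congr padic_of_cauchy.
exact/val_inj.
Qed.

Lemma padic_of_rat1 : padic_of_rat 1 = 1.
Proof.
rewrite -[RHS](rmorph1 (\pi_({ideal_quot (null_ideal p)}))).
congr padic_of_cauchy; exact/val_inj.
Qed.

HB.instance Definition _ :=
  GRing.isZmodMorphism.Build rat (padic p) padic_of_rat padic_of_ratB.
HB.instance Definition _ := GRing.isMonoidMorphism.Build rat (padic p)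
  padic_of_rat (padic_of_rat1, padic_of_ratM).

Lemma padic_of_ratE q : padic_of_rat q = ratr q.
Proof. by rewrite -[in LHS](divq_num_den q) fmorph_div !rmorph_int. Qed.

Lemma padic_norm_ratr q : padic_norm (ratr q : padic p) = abs q.
Proof.
rewrite -padic_of_ratE.
have cq : (abs q : rat^o) @[_ --> \oo] --> (padic_norm (padic_of_rat q) : rat^o).
  exact: (@padic_norm_cvg p (CauchySeq (padic_cauchy_cst p q))).
exact: (cvg_unique (@norm_hausdorff _ rat^o) cq (cvg_cst (abs q : rat^o))).
Qed.

Lemma dense_ratr : dense (range (ratr : rat -> padic p)).
Proof.
move=> O [x Ox] oO; have /nbhs_ballP[e /= e0 xO] := open_nbhs_nbhs (conj oO Ox).
have /padic_cauchyP/(_ _ (divr_gt0 e0 (ltr0n _ 2)))[N HN] :=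
  cauchy_valP (cauchy_repr x).
pose q := cauchy_repr x N; exists (ratr q); split; last by exists q.
apply: xO; rewrite ballEmdist /= /mdist /= /padic_dist -padic_of_ratE.
rewrite -{1}(cauchy_reprK x) -padic_of_cauchyB.
apply: (@le_lt_trans _ _ (e / 2)); last by rewrite ltr_pdivrMr// ltr_pMr// ltr1n.
rewrite leNgt; apply/negP => lt_e.
have := cvgr_gt _ (@padic_norm_cvg p _) _ lt_e.
move=> [M _ /(_ (maxn N M) (leq_maxr _ _)) /=]; apply/negP; rewrite -leNgt ltW//.
by apply: HN => //; exact: leq_maxl.
Qed.

End RationalPoints.

Definition ratio_set (A : set nat) : set rat :=
  [set a%:R / b%:R | a in A & b in A].

(* Main.v *)
Require Import Defs.
From mathcomp Require Import all_boot all_order all_algebra.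
From mathcomp Require Import all_classical all_reals all_analysis.

(** Sort the positive integers by the parities of their valuations at
    [p_1, ..., p_l]: this gives [2 ^ l <= k] nonempty classes, and a ratio of two
    elements of one class has even valuation at every [p_i], so it stays out of
    the ball [|x - p_i| < 1 / p_i], all of whose points have valuation 1.  To
    reach exactly [k] parts, detach singletons from the classes. *)

Import Order.TTheory GRing.Theory Num.Theory.

Local Open Scope classical_set_scope.

Lemma logn_prod (I : finType) (q : nat) (F : I -> nat) :
  (forall i, 0 < F i)%N -> logn q (\prod_i F i) = (\sum_i logn q (F i))%N.
Proof.
move=> F0; suff [] : (0 < \prod_i F i)%N /\
    logn q (\prod_i F i) = (\sum_i logn q (F i))%N by [].
apply: (big_rec2 (fun m s => (0 < m)%N /\ logn q m = s)); first by rewrite logn1.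
by move=> i m s _ [m0 <-]; rewrite muln_gt0 F0 m0 lognM.
Qed.

(** With exponents 0 and 1 this yields an integer having any prescribed parity pattern, so that no
    parity class is empty. *)
Lemma logn_prod_distinct_primes (l : nat) (p e : 'I_l -> nat) (i : 'I_l) :
  (forall j, prime (p j)) -> injective p ->
  logn (p i) (\prod_j p j ^ e j) = e i.
Proof.
move=> pp pinj; rewrite logn_prod => [|j]; last by rewrite expn_gt0 prime_gt0.
rewrite (bigD1 i) //= lognX logn_prime // eqxx muln1 big1 ?addn0 // => j ji.
by rewrite lognX logn_prime // (inj_eq pinj) eq_sym (negPf ji) muln0.
Qed.

(** Detaching finitely many non-witnesses as singletons leaves every fiber nonempty, since it keeps
    its witness [w t]; each part still lies inside one fiber. *)
Lemma partition_refining_fibers (T : finType) (c : nat -> T) (w : T -> nat)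
    (k : nat) :
  (forall t, 0 < w t)%N -> cancel w c -> (#|T| <= k)%N ->
  exists A : 'I_k -> set nat,
    partition [set: 'I_k] A [set n : nat | (0 < n)%N] /\
    forall j a b, A j a -> A j b -> c a = c b.
Proof.
move=> w0 wK Tk; have T0 : (0 < #|T|)%N by apply/card_gt0P; exists (c 0%N).
pose M := (\max_t w t)%N.
(* The extra parts are the singletons [{M + j}], [#|T| <= j < k], which avoid
   all the witnesses [w t]. *)
pose f n := if (#|T| <= n - M < k)%N then (n - M)%N else enum_rank (c n) : nat.
have fk n : (f n < k)%N.
  rewrite /f; case: ifP => [/andP[]//|_].
  by rewrite (leq_trans _ Tk).
have fw t : f (w t) = enum_rank t.
  have -> : f (w t) = enum_rank (c (w t)); last by rewrite wK.
  (* Truncated subtraction: [w t <= M] gives 0, which is below the range of the singleton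
     indices. *)
  have /eqP wM : (w t - M == 0)%N by rewrite subn_eq0 (leq_bigmax t).
  by rewrite /f wM leqNgt T0.
exists (fun j => [set n | (0 < n)%N /\ f n = j]); split; first split.
- apply/seteqP; split=> [n [j _ []]//|n n0].
  by exists (Ordinal (fk n)).
- by move=> i j _ _ [n [[_ fi] [_ fj]]]; apply/ord_inj; rewrite -fi -fj.
- move=> j _; have [jT|Tj] := ltnP j #|T|.
    exists (w (enum_val (Ordinal jT))); split; first exact: w0.
    by rewrite fw enum_valK.
  exists (M + j)%N; split; first by rewrite addn_gt0 (leq_trans T0 Tj) orbT.
  by rewrite /f addKn Tj ltn_ord.
- move=> j a b [_ <-] [_]; rewrite /f.
  (* Equal singleton indices give [a = b]; a rank is less than [#|T|], so it never equals a
     singleton index; equal ranks give equal fibers. *)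
  case: ifP => [/andP[Tb _]|_]; case: ifP => [/andP[Ta _]|_] e.
  + have aM : (M < a)%N by rewrite -subn_gt0 (leq_trans T0).
    have bM : (M < b)%N by rewrite -subn_gt0 (leq_trans T0).
    by rewrite -(subnK (ltnW aM)) -(subnK (ltnW bM)) e.
  + by move: Tb; rewrite e leqNgt ltn_ord.
  + by move: Ta; rewrite -e leqNgt ltn_ord.
  + by apply/enum_rank_inj/ord_inj.
Qed.

Lemma ratio_set_not_dense (q : nat) (A : set nat) : prime q ->
  (forall a, A a -> 0 < a)%N ->
  (forall a b, A a -> A b -> odd (logn q a) = odd (logn q b)) ->
  ~ dense ((@ratr (padic q)) @` ratio_set A).
Proof.
move=> qp A0 Aodd dA.
have q_gt0 : (0 < q%:R :> rat)%R by rewrite ltr0n prime_gt0.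
have qV_gt0 : (0 < q%:R^-1 :> rat)%R by rewrite invr_gt0.
have absq : padic_abs q q%:R = (q%:R^-1)%R.
  have qE : (q%:R = q%:~R / 1%:~R :> rat)%R by rewrite divr1.
  rewrite {1}qE padic_abs_frac ?eqz_nat -?lt0n //; last exact: prime_gt0.
  by rewrite (logn_prime q qp) eqxx /= logn1 sub0r exprN1.
pose x : padic q := ratr q%:R.
(* Density is tested on open sets, hence the interior of the ball, which still contains its
   centre. *)
have xB : (ball x q%:R^-1%R)° !=set0 by exists x; exact: nbhsx_ballx.
have [y [xy [r [a Aa [b Ab abr]] ry]]] := dA _ xB (open_interior _).
move: xy => /interior_subset; rewrite -ry -abr ballEmdist /= /mdist /=.
rewrite /padic_dist /x -!padic_of_ratE -padic_of_ratB padic_of_ratE.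
(* The radius is exactly [|q|], so a ratio in the ball satisfies [|a/b - q| < |q|], and the
   ultrametric inequality forces [|a/b| = |q|]. *)
rewrite padic_norm_ratr -padic_absN opprB -absq => /padic_abs_isosceles.
rewrite absq.
have a0 := A0 _ Aa; have b0 := A0 _ Ab.
have -> : (a%:R / b%:R = a%:~R / b%:~R :> rat)%R by [].
rewrite padic_abs_frac ?eqz_nat -?lt0n // -exprN1.
(* A power of [q] determines its exponent because [q] is positive and differs from 1. *)
move=> /ieexprIz; rewrite pnatr_eq1 => /(_ q_gt0) /=.
case: eqP qp => [->//|_ qp /(_ isT) e].
have {}e : logn q a = (logn q b).+1.
  apply/eqP; rewrite -eqz_nat -addn1 PoszD; move/eqP: e.
  by rewrite subr_eq addrC -subr_eq opprK eq_sym.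
by have := Aodd _ _ Aa Ab; rewrite e /=; case: odd.
Qed.

Theorem theorem3p2 (k : nat) (hk : (2 <= k)%N)
    (p : 'I_(trunc_log 2 k) -> nat)
    (p_prime : forall i, prime (p i))
    (p_incr : forall i j : 'I_(trunc_log 2 k), (i < j)%N -> (p i < p j)%N) :
  exists A : 'I_k -> set nat,
    partition [set: 'I_k] A [set n : nat | (0 < n)%N] /\
    forall (i : 'I_(trunc_log 2 k)) (j : 'I_k),
      ~ dense ((@ratr (padic (p i))) @` ratio_set (A j)).
Proof.
have p_inj : injective p.
  move=> i j pij; apply/val_inj.
  by case: (ltngtP i j) => // /p_incr; rewrite pij ltnn.
pose c n := [ffun i => odd (logn (p i) n)].
pose w (t : {ffun 'I_(trunc_log 2 k) -> bool}) := (\prod_i p i ^ t i)%N.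
have [||| A [A_part A_fib]] := @partition_refining_fibers _ c w k.
- by move=> t; apply: prodn_gt0 => i; rewrite expn_gt0 prime_gt0.
- move=> t; apply/ffunP => i.
  by rewrite ffunE (@logn_prod_distinct_primes _ p (fun i => t i)) // oddb.
- by rewrite card_ffun card_bool card_ord trunc_logP // (leq_trans _ hk).
exists A; split=> // i j; apply: ratio_set_not_dense => // [a Aa|a b Aa Ab].
  have [Acov _ _] := A_part.
  by have : [set n : nat | (0 < n)%N] a by rewrite -Acov; exists j.
by have /ffunP/(_ i) := A_fib _ _ _ Aa Ab; rewrite !ffunE.
Qed.
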